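(* Let $\mathcal{R}$ be a commutative ring with unity and suppose that the $\mathcal{R}$-algebra $\mathcal{A}$ has a generalized triangular matrix representation \[ \mathcal{A}=\begin{pmatrix} \mathcal{A}_{11} & \mathcal{A}_{12} & \cdots & \mathcal{A}_{1n}\\ 0 & \mathcal{A}_{22} & \cdots & \mathcal{A}_{2n}\\ \vdots & \vdots & \ddots & \vdots\\ 0 & 0 & \cdots & \mathcal{A}_{nn}\end{pmatrix}. \] Suppose that, for all $2\leq i\leq n$ and $1\leq k\leq i$, any local left multiplier from $\mathcal{A}_{ii}$ into $\mathcal{A}_{ki}$ is a left multiplier, and that $l.ann_{\mathcal{A}_{11}}\mathcal{A}_{1k}=\{0\}$ for some $2\leq k\leq n$. Then $\mathcal{A}$ is a SLIP algebra.
   Context: All algebras are associative $\mathcal{R}$-algebras with unity $1$ and all modules and bimodules are unital; modules over an $\mathcal{R}$-algebra are $\mathcal{R}$-modules in the compatible way (for bimodules, $rm=mr$ for $r\in\mathcal{R}$). An algebra has a generalized triangular matrix representation if it is isomorphic, as an $\mathcal{R}$-algebra, to an algebra of upper triangular $n\times n$ matrices with $(i,j)$-entries in $\mathcal{A}_{ij}$ ($i\le j$) and zeros below the diagonal, under the usual matrix operations, where each $\mathcal{A}_{ii}$ is an algebra with unity and each $\mathcal{A}_{ij}$ ($i<j$) is an $(\mathcal{A}_{ii},\mathcal{A}_{jj})$-bimodule (the products $\mathcal{A}_{ij}\times\mathcal{A}_{jk}\to\mathcal{A}_{ik}$ used in matrix multiplication being those making the matrices an associative algebra and extending the bimodule actions).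 For a left $\mathcal{C}$-module $\mathcal{M}$, $l.ann_{\mathcal{C}}\mathcal{M}=\{c\in\mathcal{C}: c\mathcal{M}=\{0\}\}$. For an algebra $\mathcal{C}$ and a right $\mathcal{C}$-module $\mathcal{X}$, an $\mathcal{R}$-linear map $\psi:\mathcal{C}\to\mathcal{X}$ is a left multiplier if $\psi(c)=\psi(1)c$ for all $c\in\mathcal{C}$; it is a local left multiplier if for each $c\in\mathcal{C}$ there exists $x_c\in\mathcal{X}$ with $\psi(c)=x_c c$. An $\mathcal{R}$-linear map $\psi:\mathcal{C}\to\mathcal{C}$ is LIP (left-ideal-preserving) if $\psi(\mathcal{J})\subseteq\mathcal{J}$ for every left ideal $\mathcal{J}$ of $\mathcal{C}$ (equivalently, $\psi$ is a local left multiplier from $\mathcal{C}$ to $\mathcal{C}$). The algebra $\mathcal{C}$ is SLIP if every LIP map on $\mathcal{C}$ is a left multiplier. *)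

(* Defs.v *)
From HB Require Import structures.
From mathcomp Require Import all_boot all_order all_algebra.

Set Implicit Arguments.
Unset Strict Implicit.
Unset Printing Implicit Defensive.

Import GRing.Theory.
Local Open Scope ring_scope.

(* Associative unital R-algebras.  MathComp's algType demands 1 != 0; here the
   zero algebra is allowed, since nothing prevents a diagonal corner of a
   triangular matrix algebra from vanishing.  (A pzRing analogue of algType
   cannot be inserted in the existing hierarchy, hence the plain record.) *)
Record pzAlgType (R : comPzRingType) := PzAlgType {
  pzalg_module : lmodType R;
  pzalg_one : pzalg_module;
  pzalg_mul : pzalg_module -> pzalg_module -> pzalg_module;
  pzalg_mulA : associative pzalg_mul;
  pzalg_mul1l : left_id pzalg_one pzalg_mul;
  pzalg_mul1r : right_id pzalg_one pzalg_mul;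
  pzalg_linearr : forall x, linear (fun y => pzalg_mul x y);
  pzalg_linearl : forall y, linear (fun x => pzalg_mul x y)
}.

Definition pzalg_sort (R : comPzRingType) (A : pzAlgType R) : Type :=
  pzalg_module A.
Coercion pzalg_sort : pzAlgType >-> Sortclass.

Section PzAlgebra.
Variables (R : comPzRingType) (A : pzAlgType R).

HB.instance Definition _ := GRing.Lmodule.on (pzalg_sort A).

Fact pzalg_mulDl : left_distributive (@pzalg_mul R A) +%R.
Proof. by move=> x x' y; have := pzalg_linearl y 1 x x'; rewrite !scale1r. Qed.

Fact pzalg_mulDr : right_distributive (@pzalg_mul R A) +%R.
Proof. by move=> x y y'; have := pzalg_linearr x 1 y y'; rewrite !scale1r. Qed.

HB.instance Definition _ := GRing.Zmodule_isPzRing.Build (pzalg_sort A)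
  (@pzalg_mulA R A) (@pzalg_mul1l R A) (@pzalg_mul1r R A)
  pzalg_mulDl pzalg_mulDr.

Lemma pzscalerAl (r : R) (x y : A) : r *: (x * y) = (r *: x) * y.
Proof. by have := pzalg_linearl (y : A) r x 0; rewrite !addr0 [pzalg_mul 0 y](mul0r y) addr0. Qed.

Lemma pzscalerAr (r : R) (x y : A) : r *: (x * y) = x * (r *: y).
Proof. by have := pzalg_linearr (x : A) r y 0; rewrite !addr0 [pzalg_mul x 0](mulr0 x) addr0. Qed.

End PzAlgebra.

Section Multipliers.
Variable R : comPzRingType.

(* A right C-module structure on X is given by its action X -> C -> X. *)
Definition left_multiplier (C : pzAlgType R) (X : lmodType R)
    (act : X -> C -> X) (psi : {linear C -> X}) : Prop :=
  forall c : C, psi c = act (psi 1) c.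

Definition local_left_multiplier (C : pzAlgType R) (X : lmodType R)
    (act : X -> C -> X) (psi : {linear C -> X}) : Prop :=
  forall c : C, exists x : X, psi c = act x c.

Definition left_ann (C : pzAlgType R) (M : lmodType R)
    (act : C -> M -> M) (c : C) : Prop :=
  forall m : M, act c m = 0.

Definition left_ideal (C : pzAlgType R) (J : C -> Prop) : Prop :=
  [/\ J 0, forall x y, J x -> J y -> J (x + y) & forall a x, J x -> J (a * x)].

Definition LIP (C : pzAlgType R) (psi : {linear C -> C}) : Prop :=
  forall J : C -> Prop, left_ideal J -> forall x, J x -> J (psi x).

Definition SLIP (C : pzAlgType R) : Prop :=
  forall psi : {linear C -> C}, LIP psi -> left_multiplier (C := C) (X := C) *%R psi.

End Multipliers.

(* The entries of a generalized triangular matrix algebra.  Families indexed by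
   i <= j are extended to all pairs (i, j) by zero modules (gt_lower); with this
   convention the axioms below carry no information outside
   i <= j <= k <= l.  The axioms say that gt_entry i i is an R-algebra and gt_entry i j a
   (gt_entry i i, gt_entry j j)-bimodule on which the two R-actions agree (instances of gt_mul
   in which two consecutive indices coincide), and that the remaining products
   make the matrix multiplication R-bilinear and associative. *)
Record gtm_data (R : comPzRingType) (n : nat) := GtmData {
  gt_entry :> 'I_n -> 'I_n -> lmodType R;
  gt_one : forall i, gt_entry i i;
  gt_mul : forall i j k, gt_entry i j -> gt_entry j k -> gt_entry i k;
  gt_lower : forall i j : 'I_n, (j < i)%N -> forall x : gt_entry i j, x = 0;
  gt_mul_linearr : forall i j k (x : gt_entry i j),
    linear (fun y : gt_entry j k => gt_mul x y);
  gt_mul_linearl : forall i j k (y : gt_entry j k),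
    linear (fun x : gt_entry i j => gt_mul x y);
  gt_mulA : forall i j k l
    (x : gt_entry i j) (y : gt_entry j k) (z : gt_entry k l),
    gt_mul x (gt_mul y z) = gt_mul (gt_mul x y) z;
  gt_mul1l : forall i j (x : gt_entry i j), gt_mul (gt_one i) x = x;
  gt_mul1r : forall i j (x : gt_entry i j), gt_mul x (gt_one j) = x
}.

Arguments gt_mul {R n} g {i j k} x y.

Section Theory.
Variables (R : comPzRingType) (n : nat) (D : gtm_data R n).

Lemma gt_mulDl i j k (x x' : D i j) (y : D j k) :
  gt_mul D (x + x') y = gt_mul D x y + gt_mul D x' y.
Proof. by have := gt_mul_linearl y 1 x x'; rewrite !scale1r. Qed.

Lemma gt_mulDr i j k (x : D i j) (y y' : D j k) :
  gt_mul D x (y + y') = gt_mul D x y + gt_mul D x y'.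
Proof. by have := gt_mul_linearr x 1 y y'; rewrite !scale1r. Qed.

Lemma gt_mul0l i j k (y : D j k) : gt_mul D (0 : D i j) y = 0.
Proof. by apply: (addrI (gt_mul D 0 y)); rewrite -gt_mulDl !addr0. Qed.

Lemma gt_mul0r i j k (x : D i j) : gt_mul D x (0 : D j k) = 0.
Proof. by apply: (addrI (gt_mul D x 0)); rewrite -gt_mulDr !addr0. Qed.

Lemma gt_mulZl i j k r (x : D i j) (y : D j k) :
  gt_mul D (r *: x) y = r *: gt_mul D x y.
Proof. by have := gt_mul_linearl y r x 0; rewrite !addr0 gt_mul0l addr0. Qed.

Lemma gt_mulZr i j k r (x : D i j) (y : D j k) :
  gt_mul D x (r *: y) = r *: gt_mul D x y.
Proof. by have := gt_mul_linearr x r y 0; rewrite !addr0 gt_mul0r addr0. Qed.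

Lemma gt_mul_suml i j k I (s : seq I) (F : I -> D i j) (y : D j k) :
  gt_mul D (\sum_(a <- s) F a) y = \sum_(a <- s) gt_mul D (F a) y.
Proof.
exact: (big_morph (fun x => gt_mul D x y)
  (fun x x' => gt_mulDl x x' y) (gt_mul0l _ y)).
Qed.

Lemma gt_mul_sumr i j k I (s : seq I) (F : I -> D j k) (x : D i j) :
  gt_mul D x (\sum_(a <- s) F a) = \sum_(a <- s) gt_mul D x (F a).
Proof. exact: (big_morph (gt_mul D x) (gt_mulDr x) (gt_mul0r _ x)). Qed.

Definition gt_diag (i : 'I_n) : pzAlgType R :=
  PzAlgType (@gt_mulA R n D i i i i) (@gt_mul1l R n D i i) (@gt_mul1r R n D i i)
    (@gt_mul_linearr R n D i i i) (@gt_mul_linearl R n D i i i).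

(* The action of D i i on the left and of D j j on the right of D i j. *)
Definition gt_lact i j (c : gt_diag i) (m : D i j) : D i j := gt_mul D c m.
Definition gt_ract i j (m : D i j) (c : gt_diag j) : D i j := gt_mul D m c.

(* The entries below the diagonal vanish by gt_lower. *)
Definition gtmx : Type := {dffun forall p : 'I_n * 'I_n, D p.1 p.2}.

HB.instance Definition _ := Choice.on gtmx.

Definition gtmx_of (f : forall i j, D i j) : gtmx := [ffun p => f p.1 p.2].
Definition gtmx_get (M : gtmx) i j : D i j := M (i, j).

Lemma gtmxE f i j : gtmx_get (gtmx_of f) i j = f i j.
Proof. by rewrite /gtmx_get ffunE. Qed.

Lemma gtmxP (M N : gtmx) : (forall i j, gtmx_get M i j = gtmx_get N i j) <-> M = N.
Proof. by split=> [eqMN | -> //]; apply/ffunP => -[i j]; apply: eqMN. Qed.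

Definition gtmx_add (M N : gtmx) := gtmx_of (fun i j => gtmx_get M i j + gtmx_get N i j).
Definition gtmx_opp (M : gtmx) := gtmx_of (fun i j => - gtmx_get M i j).
Definition gtmx_zero := gtmx_of (fun i j => 0).
Definition gtmx_scale (r : R) (M : gtmx) := gtmx_of (fun i j => r *: gtmx_get M i j).
Definition gtmx_mul (M N : gtmx) :=
  gtmx_of (fun i k => \sum_j gt_mul D (gtmx_get M i j) (gtmx_get N j k)).

(* 1 on the diagonal and 0 elsewhere; the cast is along i = j. *)
Definition gtmx_one := gtmx_of (fun i j =>
  match i =P j with
  | ReflectT eq_ij => ecast k (D i k) eq_ij (gt_one D i)
  | ReflectF _ => 0
  end).

Lemma gtmx_oneE i : gtmx_get gtmx_one i i = gt_one D i.
Proof.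
by rewrite gtmxE; case: eqP => // eq_ii; rewrite (eq_irrelevance eq_ii erefl).
Qed.

Lemma gtmx_one0 i j : i != j -> gtmx_get gtmx_one i j = 0.
Proof. by rewrite gtmxE; case: eqP. Qed.

Fact gtmx_addA : associative gtmx_add.
Proof. by move=> M N P; apply/gtmxP => i j; rewrite !gtmxE addrA. Qed.
Fact gtmx_addC : commutative gtmx_add.
Proof. by move=> M N; apply/gtmxP => i j; rewrite !gtmxE addrC. Qed.
Fact gtmx_add0 : left_id gtmx_zero gtmx_add.
Proof. by move=> M; apply/gtmxP => i j; rewrite !gtmxE add0r. Qed.
Fact gtmx_addN : left_inverse gtmx_zero gtmx_opp gtmx_add.
Proof. by move=> M; apply/gtmxP => i j; rewrite !gtmxE addNr. Qed.

HB.instance Definition _ :=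
  GRing.isZmodule.Build gtmx gtmx_addA gtmx_addC gtmx_add0 gtmx_addN.

Lemma gtmx_addE (M N : gtmx) i j :
  gtmx_get (M + N) i j = gtmx_get M i j + gtmx_get N i j.
Proof. exact: gtmxE. Qed.

Fact gtmx_mulA : associative gtmx_mul.
Proof.
move=> M N P; apply/gtmxP => i l; rewrite !gtmxE.
under eq_bigr do rewrite gtmxE gt_mul_sumr.
rewrite exchange_big /=; apply: eq_bigr => k _.
by rewrite gtmxE gt_mul_suml; apply: eq_bigr => j _; rewrite gt_mulA.
Qed.
Fact gtmx_mul1l : left_id gtmx_one gtmx_mul.
Proof.
move=> M; apply/gtmxP => i k; rewrite gtmxE (bigD1 i) //= gtmx_oneE gt_mul1l.
by rewrite big1 ?addr0 // => j ne_ji; rewrite gtmx_one0 1?eq_sym // gt_mul0l.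
Qed.
Fact gtmx_mul1r : right_id gtmx_one gtmx_mul.
Proof.
move=> M; apply/gtmxP => i k; rewrite gtmxE (bigD1 k) //= gtmx_oneE gt_mul1r.
by rewrite big1 ?addr0 // => j ne_jk; rewrite gtmx_one0 // gt_mul0r.
Qed.
Fact gtmx_mulDl : left_distributive gtmx_mul +%R.
Proof.
move=> M N P; apply/gtmxP => i k; rewrite gtmx_addE !gtmxE -big_split /=.
by apply: eq_bigr => j _; rewrite gtmx_addE gt_mulDl.
Qed.
Fact gtmx_mulDr : right_distributive gtmx_mul +%R.
Proof.
move=> M N P; apply/gtmxP => i k; rewrite gtmx_addE !gtmxE -big_split /=.
by apply: eq_bigr => j _; rewrite gtmx_addE gt_mulDr.
Qed.

Fact gtmx_scalerA r s (M : gtmx) :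
  gtmx_scale r (gtmx_scale s M) = gtmx_scale (r * s) M.
Proof. by apply/gtmxP => i j; rewrite !gtmxE scalerA. Qed.
Fact gtmx_scale1r : left_id 1 gtmx_scale.
Proof. by move=> M; apply/gtmxP => i j; rewrite !gtmxE scale1r. Qed.
Fact gtmx_scalerDr : right_distributive gtmx_scale +%R.
Proof. by move=> r M N; apply/gtmxP => i j; rewrite !(gtmxE, gtmx_addE) scalerDr. Qed.
Fact gtmx_scalerDl (M : gtmx) : {morph gtmx_scale^~ M : r s / r + s}.
Proof. by move=> r s; apply/gtmxP => i j; rewrite !(gtmxE, gtmx_addE) scalerDl. Qed.

HB.instance Definition _ := GRing.Zmodule_isLmodule.Build R gtmx
  gtmx_scalerA gtmx_scale1r gtmx_scalerDr gtmx_scalerDl.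

Fact gtmx_mul_linearr (M : gtmx) : linear (fun N : gtmx => gtmx_mul M N).
Proof.
move=> r N P; rewrite [LHS]gtmx_mulDr; congr (_ + _).
apply/gtmxP => i k; rewrite !gtmxE scaler_sumr.
by apply: eq_bigr => j _; rewrite gtmxE gt_mulZr.
Qed.
Fact gtmx_mul_linearl (N : gtmx) : linear (fun M : gtmx => gtmx_mul M N).
Proof.
move=> r M P; rewrite [LHS]gtmx_mulDl; congr (_ + _).
apply/gtmxP => i k; rewrite !gtmxE scaler_sumr.
by apply: eq_bigr => j _; rewrite gtmxE gt_mulZl.
Qed.

Definition gtmx_alg : pzAlgType R :=
  PzAlgType gtmx_mulA gtmx_mul1l gtmx_mul1r gtmx_mul_linearr gtmx_mul_linearl.

Definition gt_representation (A : pzAlgType R) : Prop :=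
  exists phi : {rmorphism A -> gtmx_alg}, scalable phi /\ bijective phi.

End Theory.

Arguments gt_lact {R n} D {i} j c m.
Arguments gt_ract {R n} D i {j} m c.

(* Main.v *)
Require Import Defs.
From HB Require Import structures.
From mathcomp Require Import all_boot all_order all_algebra.
Local Open Scope ring_scope.

(** Being SLIP is invariant under isomorphism, so one may take for the algebra
    the triangular matrix algebra itself, and a LIP map [psi] of it: since
    [psi M] lies in the left ideal generated by [M], it is [X * M] for some
    [X] depending on [M].

    Write [x^(ij)] for the matrix whose only nonzero entry is [x], at (i, j).
    Since left multiplication acts column by column, [psi x^(ij)] is zero
    outside column j, so by additivity it is enough to show that its column j
    is column i of [psi 1] multiplied by [x].  The device that gives this is
    [local_mul_entry]: for [j != k], a single [X] serves the matrix
    [x^(ij) + (x y)^(ik)], whose images in columns j and k do not interfere;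
    comparing them, column k of [psi (x y)^(ik)] is column j of
    [psi x^(ij)] multiplied by [y].

    - Off the diagonal ([i != j]), apply this with the unit of the i-th corner
      as first factor.
    - On the diagonal with [i > 0] (indices start at 0), the entries of
      [psi c^(ii)] at and above the diagonal are local left multipliers in
      [c], hence left multipliers by hypothesis.
    - In the first corner there is no such hypothesis, but
      [psi (c m)^(0k)] can be computed in two ways, from the factorizations
      [c m] and [1 (c m)].  Hence the defect of [psi] at [c^(00)] annihilates
      every [m] in position (0, k), and faithfulness makes it vanish. *)

Set Implicit Arguments.
Unset Strict Implicit.
Unset Printing Implicit Defensive.
Import GRing.Theory.

(** * LIP maps *)

(** Apply LIP to the left ideal generated by one element. *)
Lemma LIP_local (R : comPzRingType) (C : pzAlgType R) (psi : {linear C -> C}) :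
  LIP psi -> local_left_multiplier (C := C) (X := C) *%R psi.
Proof.
move=> lip c; apply: (lip (fun y => exists x, y = x * c)); last first.
  by exists 1; rewrite mul1r.
split=> [|_ _ [x ->] [y ->] | a _ [x ->]].
- by exists 0; rewrite mul0r.
- by exists (x + y); rewrite mulrDl.
- by exists (a * x); rewrite mulrA.
Qed.

Section Isomorphism.
Variables (R : comPzRingType) (A B : pzAlgType R).
Variables (phi : {rmorphism A -> B}) (phiZ : scalable phi).
Variables (g : B -> A) (phiK : cancel phi g) (gK : cancel g phi).
Variable psi : {linear A -> A}.

Definition conj_map (b : B) : B := phi (psi (g b)).

Fact conj_map_is_linear : linear conj_map.
Proof.
move=> r b c; rewrite /conj_map.
have ->: g (r *: b + c) = r *: g b + g c.
  by apply: (can_inj phiK); rewrite rmorphD phiZ !gK.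
by rewrite linearP rmorphD phiZ.
Qed.
HB.instance Definition _ :=
  GRing.isLinear.Build R B B *:%R conj_map conj_map_is_linear.

Lemma LIP_conj_map : LIP psi -> LIP conj_map.
Proof.
move=> lip J [J0 JD JM] b Jb.
apply: (lip (fun a => J (phi a))); last by rewrite gK.
split=> [|x y Jx Jy | a x Jx].
- by rewrite rmorph0.
- by rewrite rmorphD; apply: JD.
- by rewrite rmorphM; apply: JM.
Qed.

Lemma left_multiplier_conj_map :
  left_multiplier (C := B) (X := B) *%R conj_map ->
  left_multiplier (C := A) (X := A) *%R psi.
Proof.
move=> mult c; apply: (can_inj phiK).
have g1 : g 1 = 1 by apply: (can_inj phiK); rewrite gK rmorph1.
by have := mult (phi c); rewrite /= /conj_map g1 phiK rmorphM.
Qed.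

End Isomorphism.

Lemma SLIP_iso (R : comPzRingType) (A B : pzAlgType R)
    (phi : {rmorphism A -> B}) :
  scalable phi -> bijective phi -> SLIP B -> SLIP A.
Proof.
move=> phiZ [g phiK gK] slipB psi lip.
have /slipB := LIP_conj_map phiZ phiK gK lip.
exact: left_multiplier_conj_map.
Qed.

(** * Matrices with a single nonzero entry *)

Section SingleEntry.
Variables (R : comPzRingType) (n : nat) (D : gtm_data R n).
Local Notation get := (@gtmx_get R n D).
Local Notation one := (gtmx_one D).

(** The matrix [x^(ij)].  Multiplying [x] by entries of the identity matrix
    moves it to an arbitrary position without transport along equalities of
    indices: the product is [x] at (i, j) and 0 elsewhere. *)
Definition single i j (x : D i j) : gtmx_alg D :=
  gtmx_of (fun k l => gt_mul D (get one k i) (gt_mul D x (get one j l))).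

Lemma single_entry i j (x : D i j) : get (single x) i j = x.
Proof. by rewrite gtmxE !gtmx_oneE gt_mul1l gt_mul1r. Qed.

Lemma single_row0 i j (x : D i j) k l : k != i -> get (single x) k l = 0.
Proof. by move=> ne_ki; rewrite gtmxE (gtmx_one0 D ne_ki) gt_mul0l. Qed.

Lemma single_col0 i j (x : D i j) k l : l != j -> get (single x) k l = 0.
Proof.
by rewrite eq_sym => ne_jl; rewrite gtmxE (gtmx_one0 D ne_jl) !gt_mul0r.
Qed.

Fact single_is_linear i j : linear (@single i j).
Proof.
move=> r x y; apply/gtmxP => k l.
by rewrite gtmx_addE !gtmxE gt_mulDl gt_mulDr gt_mulZl gt_mulZr.
Qed.
HB.instance Definition _ i j :=
  GRing.isLinear.Build R (D i j) (gtmx_alg D) *:%R (@single i j)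
    (@single_is_linear i j).

Lemma gtmx_get_sum I (s : seq I) (F : I -> gtmx_alg D) i j :
  get (\sum_(a <- s) F a) i j = \sum_(a <- s) get (F a) i j.
Proof.
apply: (big_morph (fun M : gtmx_alg D => get M i j)) => [M N|].
  exact: gtmx_addE.
exact: gtmxE.
Qed.

Lemma gtmx_mulE (X M : gtmx_alg D) k l :
  get (X * M) k l = \sum_a gt_mul D (get X k a) (get M a l).
Proof. exact: gtmxE. Qed.

Lemma mul_single_entry (X : gtmx_alg D) i j (x : D i j) k :
  get (X * single x) k j = gt_mul D (get X k i) x.
Proof.
rewrite gtmx_mulE (bigD1 i) //= single_entry big1 ?addr0 // => a ne_ai.
by rewrite single_row0 // gt_mul0r.
Qed.

Lemma mul_single_col0 (X : gtmx_alg D) i j (x : D i j) k l :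
  l != j -> get (X * single x) k l = 0.
Proof.
by move=> ne_lj; rewrite gtmx_mulE big1 // => a _; rewrite single_col0 // gt_mul0r.
Qed.

Lemma gtmx_sum_single (M : gtmx_alg D) : M = \sum_i \sum_j single (get M i j).
Proof.
apply/gtmxP => k l; rewrite gtmx_get_sum (bigD1 k) //= gtmx_get_sum (bigD1 l) //=.
rewrite single_entry !big1 ?addr0 // => [i ne_ik | j ne_jl].
  by rewrite gtmx_get_sum big1 // => j _; rewrite single_row0 // eq_sym.
by rewrite single_col0 // eq_sym.
Qed.

(** * Local left multipliers of the matrix algebra *)

Section LocalMultiplier.
Variable psi : {linear gtmx_alg D -> gtmx_alg D}.
Hypothesis psi_local :
  local_left_multiplier (C := gtmx_alg D) (X := gtmx_alg D) *%R psi.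

Lemma local_single_col0 i j (x : D i j) k l :
  l != j -> get (psi (single x)) k l = 0.
Proof. by have [X ->] := psi_local (single x); apply: mul_single_col0. Qed.

Lemma local_col (M : gtmx_alg D) k j :
  get (psi M) k j = \sum_i get (psi (single (get M i j))) k j.
Proof.
rewrite {1}(gtmx_sum_single M) linear_sum gtmx_get_sum; apply: eq_bigr => i _.
rewrite linear_sum gtmx_get_sum (bigD1 j) //= big1 ?addr0 // => l ne_lj.
by rewrite local_single_col0 // eq_sym.
Qed.

Lemma local_one_entry k i :
  get (psi 1) k i = get (psi (single (gt_one D i))) k i.
Proof.
rewrite local_col (bigD1 i) //= gtmx_oneE big1 ?addr0 // => a ne_ai.
by rewrite gtmx_one0 // !linear0 gtmxE.
Qed.

(** Although [psi] is only locally a multiplication, it respects right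
    multiplication by an off-diagonal entry [y]: the same [X] acts on the two
    entries of [single x + single (x y)], which lie in different columns. *)
Lemma local_mul_entry i j k (x : D i j) (y : D j k) a : j != k ->
  get (psi (single (gt_mul D x y))) a k =
  gt_mul D (get (psi (single x)) a j) y.
Proof.
move=> ne_jk; have ne_kj : k != j by rewrite eq_sym.
have [X] := psi_local (single x + single (gt_mul D x y)).
rewrite linearD mulrDr => psiE.
have colj : get (psi (single x)) a j = gt_mul D (get X a i) x.
  have := congr1 (fun M => get M a j) psiE.
  rewrite !gtmx_addE mul_single_entry (mul_single_col0 _ _ _ ne_jk).
  by rewrite (local_single_col0 _ _ ne_jk) !addr0.
have := congr1 (fun M => get M a k) psiE.
rewrite !gtmx_addE mul_single_entry (mul_single_col0 _ _ _ ne_kj).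
rewrite (local_single_col0 _ _ ne_kj) !add0r => ->.
by rewrite colj gt_mulA.
Qed.

Lemma local_offdiag i j (x : D i j) k : i != j ->
  get (psi (single x)) k j = gt_mul D (get (psi 1) k i) x.
Proof.
by move=> ne_ij; rewrite local_one_entry -local_mul_entry // gt_mul1l.
Qed.

Definition corner_map i k (c : gt_diag D i) : D k i :=
  get (psi (single (c : D i i))) k i.

Fact corner_map_is_linear i k : linear (@corner_map i k).
Proof. by move=> r c d; rewrite /corner_map !linearP gtmx_addE gtmxE. Qed.
HB.instance Definition _ i k :=
  GRing.isLinear.Build R (gt_diag D i) (D k i) *:%R (@corner_map i k)
    (@corner_map_is_linear i k).

Lemma corner_map_local i k :
  local_left_multiplier (gt_ract D k) (@corner_map i k).
Proof.
move=> c; have [X psiE] := psi_local (single (c : D i i)).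
by exists (get X k i); rewrite /= /corner_map psiE mul_single_entry.
Qed.

(** The difference of the two sides annihilates every [m] in position (i, k):
    the off-diagonal entry [c m] can be factored both as [c m] and as
    [1 (c m)], and [local_mul_entry] applies to both factorizations. *)
Lemma local_diag_faithful i k (c : D i i) : i != k ->
  (forall d : D i i, (forall m : D i k, gt_mul D d m = 0) -> d = 0) ->
  get (psi (single c)) i i = gt_mul D (get (psi 1) i i) c.
Proof.
move=> ne_ik faithful; apply/eqP; rewrite -subr_eq0; apply/eqP.
apply: faithful => m.
rewrite gt_mulDl -[- gt_mul _ _ c]scaleN1r gt_mulZl scaleN1r.
by rewrite -local_mul_entry // local_offdiag // gt_mulA subrr.
Qed.

Lemma local_left_multiplier_entries :
  (forall i j (x : D i j) k,
     get (psi (single x)) k j = gt_mul D (get (psi 1) k i) x) ->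
  left_multiplier (C := gtmx_alg D) (X := gtmx_alg D) *%R psi.
Proof.
move=> psiE M; apply/gtmxP => k j.
by rewrite local_col gtmx_mulE; apply: eq_bigr => i _; apply: psiE.
Qed.

End LocalMultiplier.

End SingleEntry.

(** * SLIP for triangular representations *)

Theorem theorem4p2 (R : comPzRingType) (n : nat) (D : gtm_data R n.+1)
    (A : pzAlgType R) (repA : gt_representation D A)
    (local_mult : forall i k : 'I_n.+1, (0 < i)%N -> (k <= i)%N ->
       forall psi : {linear gt_diag D i -> D k i},
         local_left_multiplier (gt_ract D k) psi ->
         left_multiplier (gt_ract D k) psi)
    (faithful_row : exists2 k : 'I_n.+1, (0 < k)%N &
       forall c : gt_diag D ord0, left_ann (gt_lact D k) c <-> c = 0) :
  SLIP A.
Proof.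
have [phi [phiZ phi_bij]] := repA.
apply: (SLIP_iso phiZ phi_bij) => psi /LIP_local psi_local.
apply: local_left_multiplier_entries => // i j x k.
have [eq_ij | ne_ij] := eqVneq i j; last exact: local_offdiag.
subst j.
have [lt_ik | le_ki] := ltnP i k.
  by rewrite [LHS](gt_lower lt_ik) [RHS](gt_lower lt_ik).
have [i0 | i_gt0] := posnP i; last first.
  have mult := local_mult i k i_gt0 le_ki _
    (@corner_map_local _ _ _ _ psi_local i k).
  by rewrite local_one_entry //; apply: mult.
have [l l_gt0 faithful] := faithful_row.
have ei : i = ord0 by apply: val_inj.
have ek : k = ord0 by apply: val_inj; apply/eqP; rewrite -leqn0 -i0.
subst i k; apply: (@local_diag_faithful _ _ _ _ psi_local _ l) => // [|d dm0].
  by rewrite -val_eqE /= eq_sym -lt0n.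
exact/(faithful d).
Qed.
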